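(* Let $\hat{\mathbf Q}=\tilde{\mathbf Q}_{\mathrm{st}}+\tilde{\mathbf Q}_{\mathcal I}\epsilon\in\hat{\mathbb Q}^{n\times n}$ be a dual quaternion Hermitian matrix with eigenvalues $\lambda_1,\dots,\lambda_n$ (dual numbers) and corresponding orthonormal eigenvectors $\hat{\mathbf u}_1,\dots,\hat{\mathbf u}_n$, and let $\hat{\mathbf v}^{(0)}=\sum_{j=1}^n\hat{\mathbf u}_j\hat\alpha_j$ (with $\hat\alpha_j=\tilde\alpha_{j,\mathrm{st}}+\tilde\alpha_{j,\mathcal I}\epsilon\in\hat{\mathbb Q}$) be a dual quaternion vector with unit $2$-norm. Suppose that $\tilde{\mathbf Q}_{\mathrm{st}}\neq\mathbf O$, that $\sum_{j=1}^l|\tilde\alpha_{j,\mathrm{st}}|^2\neq0$, and that $$\lambda_{1,\mathrm{st}}=\dots=\lambda_{l,\mathrm{st}}\quad\text{and}\quad|\lambda_{1,\mathrm{st}}|>|\lambda_{l+1,\mathrm{st}}|\ge\dots\ge|\lambda_{n,\mathrm{st}}|\ge0 .$$ Let the power method sequences be defined for $k\ge1$ by $$\hat{\mathbf y}^{(k)}=\hat{\mathbf Q}\hat{\mathbf v}^{(k-1)},\qquad \lambda^{(k-1)}=(\hat{\mathbf v}^{(k-1)})^*\hat{\mathbf y}^{(k)},\qquad \hat{\mathbf v}^{(k)}=\frac{\hat{\mathbf y}^{(k)}}{\|\hat{\mathbf y}^{(k)}\|_2}.$$ Put $s=\mathrm{sgn}(\lambda_{1,\mathrm{st}})$ and $\tilde\gamma_{j,\mathrm{st}}=\tilde\alpha_{j,\mathrm{st}}\big/\sqrt{\sum_{i=1}^l|\tilde\alpha_{i,\mathrm{st}}|^2}$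 for $j=1,\dots,l$. Then the standard parts satisfy $$\tilde{\mathbf v}^{(k)}_{\mathrm{st}}=s^k\sum_{j=1}^l\tilde{\mathbf u}_{j,\mathrm{st}}\tilde\gamma_{j,\mathrm{st}}\left(1+O\!\left(\left|\frac{\lambda_{l+1,\mathrm{st}}}{\lambda_{1,\mathrm{st}}}\right|^{k}\right)\right)$$ and $$\lambda^{(k)}_{\mathrm{st}}=\big(\tilde{\mathbf v}^{(k)}_{\mathrm{st}}\big)^*\tilde{\mathbf y}^{(k+1)}_{\mathrm{st}}=\lambda_{1,\mathrm{st}}\left(1+O\!\left(\left|\frac{\lambda_{l+1,\mathrm{st}}}{\lambda_{1,\mathrm{st}}}\right|^{2k}\right)\right).$$ In other words, the sequence $\tilde{\mathbf v}^{(k)}_{\mathrm{st}}s^k$ converges to $\sum_{j=1}^l\tilde{\mathbf u}_{j,\mathrm{st}}\tilde\gamma_{j,\mathrm{st}}$ at a rate of $O\big(|\lambda_{l+1,\mathrm{st}}/\lambda_{1,\mathrm{st}}|^{k}\big)$, and the sequence $\lambda^{(k)}_{\mathrm{st}}$ converges to $\lambda_{1,\mathrm{st}}$ at a rate of $O\big(|\lambda_{l+1,\mathrm{st}}/\lambda_{1,\mathrm{st}}|^{2k}\big)$.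
   Context: Dual numbers: $a=a_{\mathrm{st}}+a_{\mathcal I}\epsilon$, $a_{\mathrm{st}},a_{\mathcal I}\in\mathbb R$, $\epsilon\neq0$, $\epsilon^2=0$; $a_{\mathrm{st}}$ is the standard part and $a_{\mathcal I}$ the dual part. If $a_{\mathrm{st}}>0$, $\sqrt a=\sqrt{a_{\mathrm{st}}}+\frac{a_{\mathcal I}}{2\sqrt{a_{\mathrm{st}}}}\epsilon$. $\mathbb Q$ is the set of real (Hamilton) quaternions with conjugate $\tilde q^*$, magnitude $|\tilde q|$, scalar part $sc(\tilde q)=\frac12(\tilde q+\tilde q^* )$. Dual quaternions $\hat{\mathbb Q}$: $\hat q=\tilde q_{\mathrm{st}}+\tilde q_{\mathcal I}\epsilon$, $\tilde q_{\mathrm{st}},\tilde q_{\mathcal I}\in\mathbb Q$, with $\epsilon$ commuting with quaternions, and $\hat q^*=\tilde q_{\mathrm{st}}^*+\tilde q_{\mathcal I}^*\epsilon$. The magnitude is $|\hat q|=|\tilde q_{\mathrm{st}}|+\frac{sc(\tilde q_{\mathrm{st}}^*\tilde q_{\mathcal I})}{|\tilde q_{\mathrm{st}}|}\epsilon$ if $\tilde q_{\mathrm{st}}\neq\tilde0$, and $|\tilde q_{\mathcal I}|\epsilon$ otherwise. The $2$-norm of $\hat{\mathbf x}=\tilde{\mathbf x}_{\mathrm{st}}+\tilde{\mathbf x}_{\mathcal I}\epsilon\in\hat{\mathbb Q}^{n\times1}$ is $\sqrt{\sum_i|\hat x_i|^2}$ if $\tilde{\mathbf x}_{\mathrm{st}}\ne\mathbf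 0$ and $\sqrt{\sum_i|\tilde x_{i,\mathcal I}|^2}\,\epsilon$ otherwise. For a dual number $a$ with $a_{\mathrm{st}}\neq0$, $\frac{\hat q}{a}=\frac{\tilde q_{\mathrm{st}}}{a_{\mathrm{st}}}+\left(\frac{\tilde q_{\mathcal I}}{a_{\mathrm{st}}}-\frac{\tilde q_{\mathrm{st}}}{a_{\mathrm{st}}}\frac{a_{\mathcal I}}{a_{\mathrm{st}}}\right)\epsilon$, entrywise for vectors. $\hat{\mathbf Q}$ is Hermitian if it equals its conjugate transpose; $^*$ denotes conjugate transpose. An eigenvalue of $\hat{\mathbf Q}$ is a dual number $\lambda$ with $\hat{\mathbf Q}\hat{\mathbf u}=\hat{\mathbf u}\lambda$ for some $\hat{\mathbf u}$ with nonzero standard part (an eigenvector). It is known that an $n\times n$ dual quaternion Hermitian matrix has exactly $n$ eigenvalues (with multiplicity), all dual numbers, and $n$ eigenvectors with $\hat{\mathbf Q}\hat{\mathbf u}_i=\hat{\mathbf u}_i\lambda_i$, $\hat{\mathbf u}_i^*\hat{\mathbf u}_j=\hat1$ if $i=j$ and $\hat0$ otherwise, forming an orthonormal basis of $\hat{\mathbb Q}^{n\times1}$. *)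

(* Defs.v *)
From HB Require Import structures.
From mathcomp Require Import all_boot all_order all_algebra.
From mathcomp Require Import all_classical all_reals all_analysis.
From mathcomp Require Import ring.

Set Implicit Arguments.
Unset Strict Implicit.
Unset Printing Implicit Defensive.

Import Order.TTheory GRing.Theory Num.Theory.
Import numFieldNormedType.Exports.

Local Open Scope ring_scope.

(** Hamilton quaternions [qre + qi i + qj j + qk k]. *)

Record quat (R : Type) := Quat { qre : R; qi : R; qj : R; qk : R }.

Section QuatChoice.
Variable R : choiceType.

Definition tuple_of_quat (q : quat R) := (qre q, qi q, qj q, qk q).
Definition quat_of_tuple (t : R * R * R * R) :=
  let: (a, b, c, d) := t in Quat a b c d.

Lemma tuple_of_quatK : cancel tuple_of_quat quat_of_tuple.
Proof. by case. Qed.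

HB.instance Definition _ := Choice.copy (quat R) (can_type tuple_of_quatK).

End QuatChoice.

Section QuatRing.
Variable R : comNzRingType.
Implicit Types p q : quat R.

Definition addq p q :=
  Quat (qre p + qre q) (qi p + qi q) (qj p + qj q) (qk p + qk q).
Definition oppq q := Quat (- qre q) (- qi q) (- qj q) (- qk q).
Definition mulq p q :=
  Quat (qre p * qre q - qi p * qi q - qj p * qj q - qk p * qk q)
       (qre p * qi q + qi p * qre q + qj p * qk q - qk p * qj q)
       (qre p * qj q - qi p * qk q + qj p * qre q + qk p * qi q)
       (qre p * qk q + qi p * qj q - qj p * qi q + qk p * qre q).
Definition zeroq : quat R := Quat 0 0 0 0.
Definition oneq : quat R := Quat 1 0 0 0.

Lemma addqA : associative addq.
Proof. by move=> p q r; congr Quat; rewrite /= addrA. Qed.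
Lemma addqC : commutative addq.
Proof. by move=> p q; congr Quat; rewrite /= addrC. Qed.
Lemma add0q : left_id zeroq addq.
Proof. by case=> *; congr Quat; rewrite /= add0r. Qed.
Lemma addNq : left_inverse zeroq oppq addq.
Proof. by move=> p; congr Quat; rewrite /= addNr. Qed.

HB.instance Definition _ :=
  GRing.isZmodule.Build (quat R) addqA addqC add0q addNq.

Lemma mulqA : associative mulq.
Proof. by move=> p q r; congr Quat => /=; ring. Qed.
Lemma mul1q : left_id oneq mulq.
Proof. by case=> *; congr Quat => /=; ring. Qed.
Lemma mulq1 : right_id oneq mulq.
Proof. by case=> *; congr Quat => /=; ring. Qed.
Lemma mulqDl : left_distributive mulq addq.
Proof. by move=> p q r; congr Quat => /=; ring. Qed.
Lemma mulqDr : right_distributive mulq addq.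
Proof. by move=> p q r; congr Quat => /=; ring. Qed.
Lemma oneq_neq0 : oneq != zeroq.
Proof. by apply/eqP => -[] /eqP; rewrite oner_eq0. Qed.

HB.instance Definition _ :=
  GRing.Zmodule_isNzRing.Build (quat R) mulqA mul1q mulq1 mulqDl mulqDr oneq_neq0.

Definition qreal (a : R) : quat R := Quat a 0 0 0.
Definition qconj q : quat R := Quat (qre q) (- qi q) (- qj q) (- qk q).

(** The scalar part, as an element of [R] rather than a real quaternion. *)
Definition qsc q : R := qre q.

End QuatRing.

Section QuatReal.
Variable R : realType.
Implicit Types q : quat R.

Definition qabs q : R :=
  Num.sqrt (qre q ^+ 2 + qi q ^+ 2 + qj q ^+ 2 + qk q ^+ 2).

Definition qdiv q (a : R) : quat R := q * qreal a^-1.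

Lemma qscE q : qreal (qsc q) = qreal 2^-1 * (q + qconj q).
Proof. by rewrite /qsc; congr Quat => /=; field. Qed.

Lemma qconj_mul q : qconj q * q = qreal (qabs q ^+ 2).
Proof.
rewrite /qabs sqr_sqrtr; last by rewrite !addr_ge0 ?sqr_ge0.
by congr Quat => /=; ring.
Qed.

End QuatReal.

(** [dual A] is [A[eps] / (eps^2)], with [eps] central:
    [dual R] are the dual numbers, [dual (quat R)] the dual quaternions. *)

Record dual (A : Type) := Dual { st : A; du : A }.

Section DualChoice.
Variable A : choiceType.

Definition pair_of_dual (x : dual A) := (st x, du x).
Definition dual_of_pair (t : A * A) := Dual t.1 t.2.

Lemma pair_of_dualK : cancel pair_of_dual dual_of_pair.
Proof. by case. Qed.

HB.instance Definition _ := Choice.copy (dual A) (can_type pair_of_dualK).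

End DualChoice.

Section DualRing.
Variable A : nzRingType.
Implicit Types x y : dual A.

Definition addd x y := Dual (st x + st y) (du x + du y).
Definition oppd x := Dual (- st x) (- du x).
Definition muld x y := Dual (st x * st y) (st x * du y + du x * st y).
Definition zerod : dual A := Dual 0 0.
Definition oned : dual A := Dual 1 0.

Lemma adddA : associative addd.
Proof. by move=> x y z; congr Dual; rewrite /= addrA. Qed.
Lemma adddC : commutative addd.
Proof. by move=> x y; congr Dual; rewrite /= addrC. Qed.
Lemma add0d : left_id zerod addd.
Proof. by case=> *; congr Dual; rewrite /= add0r. Qed.
Lemma addNd : left_inverse zerod oppd addd.
Proof. by move=> x; congr Dual; rewrite /= addNr. Qed.

HB.instance Definition _ :=
  GRing.isZmodule.Build (dual A) adddA adddC add0d addNd.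

Lemma muldA : associative muld.
Proof.
move=> x y z; congr Dual => /=; first by rewrite mulrA.
by rewrite mulrDr mulrDl !mulrA addrA.
Qed.
Lemma mul1d : left_id oned muld.
Proof. by case=> *; congr Dual; rewrite /= !mul1r // mul0r addr0. Qed.
Lemma muld1 : right_id oned muld.
Proof. by case=> *; congr Dual; rewrite /= !mulr1 // mulr0 add0r. Qed.
Lemma muldDl : left_distributive muld addd.
Proof.
by move=> x y z; congr Dual => /=; rewrite !mulrDl // addrACA.
Qed.
Lemma muldDr : right_distributive muld addd.
Proof.
by move=> x y z; congr Dual => /=; rewrite !mulrDr // addrACA.
Qed.
Lemma oned_neq0 : oned != zerod.
Proof. by apply/eqP => -[] /eqP; rewrite oner_eq0. Qed.

HB.instance Definition _ :=
  GRing.Zmodule_isNzRing.Build (dual A) muldA mul1d muld1 muldDl muldDr oned_neq0.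

End DualRing.

(** Entries [x_i * a]; scalars act on the right of column vectors. *)
Definition rscale (A : nzRingType) n (x : 'cV[A]_n) (a : A) : 'cV[A]_n :=
  map_mx (fun q => q * a) x.

Section DualQuaternion.
Variable R : realType.

(** Only meaningful when [st a > 0]. *)
Definition dsqrt (a : dual R) : dual R :=
  Dual (Num.sqrt (st a)) (du a / (2 * Num.sqrt (st a))).

Definition dqreal (a : dual R) : dual (quat R) :=
  Dual (qreal (st a)) (qreal (du a)).

Definition dqconj (q : dual (quat R)) : dual (quat R) :=
  Dual (qconj (st q)) (qconj (du q)).

Definition dqabs (q : dual (quat R)) : dual R :=
  if st q != 0 then
    Dual (qabs (st q)) (qsc (qconj (st q) * du q) / qabs (st q))
  else Dual 0 (qabs (du q)).

(** Only meaningful when [st a != 0]. *)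
Definition dqdiv (q : dual (quat R)) (a : dual R) : dual (quat R) :=
  Dual (qdiv (st q) (st a))
       (qdiv (du q) (st a) - qdiv (st q) (st a) * qreal (du a / st a)).

Definition mst m n (M : 'M[dual (quat R)]_(m, n)) : 'M[quat R]_(m, n) :=
  map_mx (@st _) M.
Definition mdu m n (M : 'M[dual (quat R)]_(m, n)) : 'M[quat R]_(m, n) :=
  map_mx (@du _) M.

Definition qctr m n (M : 'M[quat R]_(m, n)) : 'M[quat R]_(n, m) :=
  map_mx (@qconj R) M^T.
Definition dqctr m n (M : 'M[dual (quat R)]_(m, n)) : 'M[dual (quat R)]_(n, m) :=
  map_mx dqconj M^T.

Definition qnorm2 n (x : 'cV[quat R]_n) : R :=
  Num.sqrt (\sum_i qabs (x i 0) ^+ 2).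

Definition dqnorm2 n (x : 'cV[dual (quat R)]_n) : dual R :=
  if mst x != 0 then dsqrt (\sum_i dqabs (x i 0) ^+ 2)
  else Dual 0 (Num.sqrt (\sum_i qabs (mdu x i 0) ^+ 2)).

Definition dqhermitian n (Q : 'M[dual (quat R)]_n) := dqctr Q = Q.

Definition eigenpair n (Q : 'M[dual (quat R)]_n) (lam : dual R)
    (u : 'cV[dual (quat R)]_n) :=
  mst u != 0 /\ Q *m u = rscale u (dqreal lam).

Definition orthonormal_family m n (u : 'I_m -> 'cV[dual (quat R)]_n) :=
  forall i j, (dqctr (u i) *m u j) 0 0 = (i == j)%:R.

End DualQuaternion.

(* Main.v *)
Require Import Defs.
From HB Require Import structures.
From mathcomp Require Import all_boot all_order all_algebra.
From mathcomp Require Import all_classical all_reals all_analysis.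
From mathcomp Require Import ring lra.

(** Only standard parts enter the conclusion, and taking standard parts turns
    the dual iteration into the quaternion power method for [A = mst Q]: the
    map [mst] is multiplicative, and the standard part of the dual 2-norm is the
    2-norm of the standard part ([st_dqnorm2]), whichever branch of the
    definition applies.

    Write [U j], [a j], [L j] for the standard parts of [u j], [alpha j],
    [lam j], and let [m j = |a j|^2].  Since [A *m U j] is [U j] times the real
    number [L j], and reals are central among quaternions, the [k]-th iterate is
    the sum over [j] of [U j * (L j ^+ k / N k) * a j], where [N k] is the square
    root of [\sum_j L j ^+ (2 * k) * m j] ([normalized_power]).  The [U j] being
    orthonormal, the inner product of two vectors that arise from the
    [U j * a j] by real coefficients [c j], [d j] is the real number
    [\sum_j c j * d j * m j] ([qdot_reweight]).  Noncommutativity disappears,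
    and two estimates on real sums remain.

    Both are controlled by the fraction [leak k] of [N k ^+ 2] contributed by
    the indices outside the dominant eigenvalue [x].  Those indices satisfy
    [|L j| <= r * |x|], so [leak k] is at most [T / S * r ^+ (2 * k)], with [S]
    and [T] the total weights inside and outside.
    - The sign-corrected iterate and its limit are unit vectors whose inner
      product [q] satisfies [q ^+ 2 = 1 - leak k] and [0 <= q <= 1], so their
      squared distance [2 - 2 * q] is at most [2 * leak k]
      ([normalized_weights_error]); the square root gives the rate [r ^+ k].
    - The Rayleigh quotient is an average of the [L j] in which a share [leak k]
      falls on values other than [x], so it is off by at most
      [2 * |x| * leak k] ([rayleigh_weights_error]); no square root is taken,
      which is why the eigenvalue converges twice as fast as the vector. *)

Set Implicit Arguments.
Unset Strict Implicit.
Unset Printing Implicit Defensive.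

Import Order.TTheory GRing.Theory Num.Theory.
Import numFieldNormedType.Exports.

Local Open Scope classical_set_scope.
Local Open Scope ring_scope.

(** * Quaternions and quaternion vectors *)

Lemma qconjM (R : comNzRingType) (p q : quat R) :
  qconj (p * q) = qconj q * qconj p.
Proof. by congr Quat => /=; ring. Qed.

Lemma qconj_sum (R : comNzRingType) (I : finType) (F : I -> quat R) :
  qconj (\sum_i F i) = \sum_i qconj (F i).
Proof.
apply: (big_morph (@qconj R)); last by congr Quat => /=; rewrite ?oppr0.
by move=> p q; congr Quat => /=; rewrite ?opprD.
Qed.

Lemma qreal_central (R : comNzRingType) (a : R) (q : quat R) :
  qreal a * q = q * qreal a.
Proof. by congr Quat => /=; ring. Qed.

Lemma qrealM (R : comNzRingType) (a b : R) :
  qreal (a * b) = qreal a * qreal b.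
Proof. by congr Quat => /=; ring. Qed.

Lemma qrealB (R : comNzRingType) (a b : R) :
  qreal (a - b) = qreal a - qreal b.
Proof. by congr Quat => /=; ring. Qed.

Lemma qreal_sum (R : comNzRingType) (I : finType) (F : I -> R) :
  qreal (\sum_i F i) = \sum_i qreal (F i).
Proof.
by apply: (big_morph (@qreal R)) => // a b; congr Quat => /=; rewrite addr0.
Qed.

Lemma qconj_qreal (R : comNzRingType) (a : R) : qconj (qreal a) = qreal a.
Proof. by congr Quat => /=; rewrite oppr0. Qed.

Lemma qabs_qreal (R : realType) (a : R) : qabs (qreal a) = `|a|.
Proof. by rewrite /qabs /= expr0n /= !addr0 sqrtr_sqr. Qed.

Lemma qabs0 (R : realType) : qabs (0 : quat R) = 0.
Proof. by rewrite (qabs_qreal 0) normr0. Qed.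

Definition qdot (R : realType) n (x y : 'cV[quat R]_n) : quat R :=
  (qctr x *m y) 0 0.

Lemma qdotE (R : realType) n (x y : 'cV[quat R]_n) :
  qdot x y = \sum_i qconj (x i 0) * y i 0.
Proof. by rewrite /qdot mxE; apply: eq_bigr => i _; rewrite !mxE. Qed.

Lemma qdot_rscale (R : realType) n (x y : 'cV[quat R]_n) (a b : quat R) :
  qdot (rscale x a) (rscale y b) = qconj a * qdot x y * b.
Proof.
rewrite !qdotE mulr_sumr mulr_suml; apply: eq_bigr => i _.
by rewrite !mxE qconjM !mulrA.
Qed.

Lemma qdot_sum (R : realType) n (I : finType) (x y : I -> 'cV[quat R]_n) :
  qdot (\sum_i x i) (\sum_j y j) = \sum_i \sum_j qdot (x i) (y j).
Proof.
transitivity (\sum_k \sum_i \sum_j qconj (x i k 0) * y j k 0).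
  rewrite qdotE; apply: eq_bigr => k _; rewrite !summxE qconj_sum mulr_suml.
  by apply: eq_bigr => i _; rewrite mulr_sumr.
rewrite exchange_big; apply: eq_bigr => i _ /=.
rewrite exchange_big; apply: eq_bigr => j _ /=.
by rewrite qdotE.
Qed.

Lemma qdotxx (R : realType) n (x : 'cV[quat R]_n) :
  qdot x x = qreal (qnorm2 x ^+ 2).
Proof.
rewrite /qnorm2 sqr_sqrtr; last by apply: sumr_ge0 => i _; rewrite sqr_ge0.
by rewrite qdotE qreal_sum; apply: eq_bigr => i _; rewrite qconj_mul.
Qed.

Lemma rscaleM (R : realType) n (x : 'cV[quat R]_n) (a b : quat R) :
  rscale (rscale x a) b = rscale x (a * b).
Proof. by apply/matrixP => i j; rewrite !mxE mulrA. Qed.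

Lemma mulmx_rscale (R : realType) m n (A : 'M[quat R]_(m, n))
    (x : 'cV[quat R]_n) (a : quat R) :
  A *m rscale x a = rscale (A *m x) a.
Proof.
apply/matrixP => i j; rewrite !mxE mulr_suml.
by apply: eq_bigr => k _; rewrite !mxE mulrA.
Qed.

(** * Standard parts *)

Lemma mst_mul (R : realType) m n p (A : 'M[dual (quat R)]_(m, n))
    (B : 'M[dual (quat R)]_(n, p)) :
  mst (A *m B) = mst A *m mst B.
Proof.
apply/matrixP => i j; rewrite !mxE.
rewrite (big_morph (@st _) (fun _ _ => erefl) erefl).
by apply: eq_bigr => k _; rewrite !mxE.
Qed.

Lemma mst_sum (R : realType) m n (I : finType)
    (F : I -> 'M[dual (quat R)]_(m, n)) :
  mst (\sum_i F i) = \sum_i mst (F i).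
Proof.
apply/matrixP => i j; rewrite mxE !summxE.
rewrite (big_morph (@st _) (fun _ _ => erefl) erefl).
by apply: eq_bigr => k _; rewrite mxE.
Qed.

Lemma mst_rscale (R : realType) n (x : 'cV[dual (quat R)]_n)
    (a : dual (quat R)) :
  mst (rscale x a) = rscale (mst x) (st a).
Proof. by apply/matrixP => i j; rewrite !mxE. Qed.

Lemma mst_dqctr (R : realType) m n (A : 'M[dual (quat R)]_(m, n)) :
  mst (dqctr A) = qctr (mst A).
Proof. by apply/matrixP => i j; rewrite !mxE. Qed.

Lemma st_dqdot (R : realType) n (x y : 'cV[dual (quat R)]_n) :
  st ((dqctr x *m y) 0 0) = qdot (mst x) (mst y).
Proof. by rewrite /qdot -mst_dqctr -mst_mul [RHS]mxE. Qed.

(** Both branches of the magnitude and of the 2-norm have the ordinary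
    magnitude, resp. 2-norm, of the standard part as their standard part; so
    the iteration never has to be split according to which branch applies. *)
Lemma st_dqnorm2 (R : realType) n (x : 'cV[dual (quat R)]_n) :
  st (dqnorm2 x) = qnorm2 (mst x).
Proof.
have st_abs (q : dual (quat R)) : st (dqabs q) = qabs (st q).
  by rewrite /dqabs; case: eqP => [->|] //=; rewrite qabs0.
rewrite /dqnorm2; case: eqP => [x0|_] /=.
  rewrite x0 /qnorm2 big1 ?sqrtr0 // => i _.
  by rewrite mxE qabs0 expr0n.
rewrite (big_morph (@st _) (fun _ _ => erefl) erefl) /qnorm2.
by congr Num.sqrt; apply: eq_bigr => i _; rewrite /= st_abs mxE.
Qed.

Lemma mst_normalize (R : realType) n (x : 'cV[dual (quat R)]_n) :
  mst (map_mx (fun q => dqdiv q (dqnorm2 x)) x)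
    = rscale (mst x) (qreal (qnorm2 (mst x))^-1).
Proof. by apply/matrixP => i j; rewrite !mxE /= st_dqnorm2. Qed.

(** * Real multiples of the components of a vector *)

(** The power method only ever multiplies the component [rscale (U j) (a j)]
    of the start vector along [U j] by a real number [c j]. *)
Definition reweight (R : realType) n (I : finType)
    (U : I -> 'cV[quat R]_n) (a : I -> quat R) (c : I -> R) : 'cV[quat R]_n :=
  \sum_j rscale (U j) (qreal (c j) * a j).

Section Reweight.
Variables (R : realType) (n : nat) (I : finType).
Variables (U : I -> 'cV[quat R]_n) (a : I -> quat R).
Implicit Types c d : I -> R.

Lemma eq_reweight c d : c =1 d -> reweight U a c = reweight U a d.
Proof. by move=> cd; apply: eq_bigr => j _; rewrite cd. Qed.

Lemma rscale_reweight c (t : R) :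
  rscale (reweight U a c) (qreal t) = reweight U a (fun j => c j * t).
Proof.
apply/matrixP => i k; rewrite mxE !summxE mulr_suml; apply: eq_bigr => j _.
by rewrite !mxE qrealM -!mulrA -[in LHS]qreal_central.
Qed.

Lemma reweightB c d :
  reweight U a c - reweight U a d = reweight U a (fun j => c j - d j).
Proof.
rewrite -sumrB; apply: eq_bigr => j _; apply/matrixP => i k.
by rewrite !mxE qrealB mulrBl mulrBr.
Qed.

Lemma mulmx_reweight (A : 'M[quat R]_n) (L : I -> R) c :
  (forall j, A *m U j = rscale (U j) (qreal (L j))) ->
  A *m reweight U a c = reweight U a (fun j => L j * c j).
Proof.
move=> AU; rewrite mulmx_sumr; apply: eq_bigr => j _.
by rewrite mulmx_rscale AU rscaleM qrealM mulrA.
Qed.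

Hypothesis U_orth : forall i j, qdot (U i) (U j) = (i == j)%:R.

(** Although quaternions do not commute, [qconj (a j) * a j] is real, so inner
    products of reweighted vectors are real weighted sums. *)
Lemma qdot_reweight c d :
  qdot (reweight U a c) (reweight U a d)
    = qreal (\sum_j c j * d j * qabs (a j) ^+ 2).
Proof.
rewrite qdot_sum qreal_sum; apply: eq_bigr => i _.
rewrite (bigD1 i) //= big1 => [|j /negPf ji]; last first.
  by rewrite qdot_rscale U_orth eq_sym ji mulr0 mul0r.
rewrite addr0 qdot_rscale U_orth eqxx mulr1 qconjM qconj_qreal.
rewrite qrealM -qconj_mul qrealM !mulrA -[_ * qreal (c i)]qreal_central.
by rewrite -[_ * _ * qreal (d i)]mulrA -[_ * qreal (d i)]qreal_central !mulrA.
Qed.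

Lemma qnorm2_reweight c :
  qnorm2 (reweight U a c) = Num.sqrt (\sum_j c j ^+ 2 * qabs (a j) ^+ 2).
Proof.
have := qdotxx (reweight U a c); rewrite qdot_reweight => -[->].
by rewrite sqrtr_sqr ger0_norm // sqrtr_ge0.
Qed.

(** The normalizations telescope: after [k] steps the vector is
    [A ^+ k] applied to the start vector, divided once by its norm. *)
Lemma normalized_power (A : 'M[quat R]_n) (L : I -> R)
    (V : nat -> 'cV[quat R]_n) :
  (forall j, A *m U j = rscale (U j) (qreal (L j))) ->
  V 0%N = reweight U a (fun=> 1) -> qnorm2 (V 0%N) = 1 ->
  (forall k, V k.+1 = rscale (A *m V k) (qreal (qnorm2 (A *m V k))^-1)) ->
  (forall k, 0 < \sum_j (L j ^+ k) ^+ 2 * qabs (a j) ^+ 2) ->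
  forall k, V k = reweight U a (fun j =>
    L j ^+ k / Num.sqrt (\sum_j (L j ^+ k) ^+ 2 * qabs (a j) ^+ 2)).
Proof.
move=> AU V0 nV0 VS mass_gt0.
elim=> [|k IH].
  rewrite V0; apply: eq_reweight => j; rewrite V0 qnorm2_reweight in nV0.
  have -> : Num.sqrt (\sum_j (L j ^+ 0) ^+ 2 * qabs (a j) ^+ 2) = 1.
    by rewrite -[RHS]nV0.
  by rewrite expr0 divr1.
rewrite VS IH (mulmx_reweight _ AU) rscale_reweight qnorm2_reweight.
set N := fun k => \sum_j (L j ^+ k) ^+ 2 * qabs (a j) ^+ 2.
rewrite -/(N k) -/(N k.+1); have Nk : 0 < N k := mass_gt0 k.
have -> : \sum_j (L j * (L j ^+ k / Num.sqrt (N k))) ^+ 2 * qabs (a j) ^+ 2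
          = N k.+1 / N k.
  rewrite mulr_suml; apply: eq_bigr => j _.
  by rewrite [L j ^+ k.+1]exprS !exprMn exprVn sqr_sqrtr ?ltW //; ring.
apply: eq_reweight => j; have := mass_gt0 k.+1; rewrite -/(N k.+1).
move: (N k.+1) (N k) Nk => N1 N0 N0_gt0 N1_gt0.
rewrite sqrtrM ?(ltW N1_gt0) // sqrtrV ?(ltW N0_gt0) // exprS.
have n0 : Num.sqrt N0 != 0 by rewrite gt_eqF // sqrtr_gt0.
have n1 : Num.sqrt N1 != 0 by rewrite gt_eqF // sqrtr_gt0.
by field; rewrite n0 n1.
Qed.

End Reweight.

(** * Estimates for the real weighted sums *)

Section DominantWeights.
Variables (R : realType) (I : finType) (P : pred I) (L m : I -> R) (x r : R).
Hypothesis m_ge0 : forall j, 0 <= m j.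
Hypothesis L_dom : forall j, P j -> L j = x.
Hypothesis L_sub : forall j, ~~ P j -> `|L j| <= r * `|x|.
Hypothesis r_ge0 : 0 <= r.
Hypothesis r_le1 : r <= 1.
Hypothesis x_neq0 : x != 0.
Hypothesis dom_gt0 : 0 < \sum_(j | P j) m j.

Let S := \sum_(j | P j) m j.
Let T := \sum_(j | ~~ P j) m j.
Let mass k := \sum_j (L j ^+ k) ^+ 2 * m j.
Let tail k := \sum_(j | ~~ P j) (L j ^+ k) ^+ 2 * m j.

Let tail_ge0 k : 0 <= tail k.
Proof. by apply: sumr_ge0 => j _; rewrite mulr_ge0 ?sqr_ge0. Qed.

Let mass_split k : mass k = (x ^+ k) ^+ 2 * S + tail k.
Proof.
rewrite /mass (bigID P) /=; congr (_ + _); rewrite /S mulr_sumr.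
by apply: eq_bigr => j Pj; rewrite L_dom.
Qed.

Let head_gt0 k : 0 < (x ^+ k) ^+ 2 * S.
Proof. by rewrite mulr_gt0 // exprn_even_gt0 //= expf_neq0. Qed.

Lemma mass_gt0 k : 0 < mass k.
Proof. by rewrite mass_split ltr_wpDr. Qed.

(** The fraction of the squared norm outside the dominant eigenspace; both
    the vector error and the eigenvalue error are controlled by it. *)
Let leak k := tail k / mass k.

Let leak_bound k : leak k <= T / S * (r ^+ k) ^+ 2.
Proof.
have tailT : tail k <= (r ^+ k) ^+ 2 * (x ^+ k) ^+ 2 * T.
  rewrite mulr_sumr; apply: ler_sum => j Pj; apply: ler_wpM2r => //.
  rewrite -exprMn -[X in X <= _]real_normK ?num_real //.
  rewrite -[X in _ <= X]real_normK ?num_real //.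
  rewrite !lerXn2r ?nnegrE ?normr_ge0 // normrM !normrX (ger0_norm r_ge0).
  by rewrite -exprMn lerXn2r ?nnegrE ?mulr_ge0 // L_sub.
rewrite /leak ler_pdivrMr ?mass_gt0 //; apply: (le_trans tailT).
have -> : (r ^+ k) ^+ 2 * (x ^+ k) ^+ 2 * T
          = T / S * (r ^+ k) ^+ 2 * ((x ^+ k) ^+ 2 * S).
  by field; rewrite gt_eqF.
apply: ler_wpM2l; last by rewrite mass_split lerDl.
by rewrite mulr_ge0 ?sqr_ge0 // divr_ge0 ?(ltW dom_gt0) // sumr_ge0.
Qed.

(** The two families of coefficients describe unit vectors with inner product
    [q = Num.sqrt S * |x| ^+ k / Num.sqrt (mass k)], so the sum is [2 - 2 * q];
    moreover [q ^+ 2] is the fraction of the mass inside [P], that is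
    [1 - leak k]. *)
Lemma normalized_weights_error k :
  \sum_j (L j ^+ k / Num.sqrt (mass k) * Num.sg x ^+ k
          - (if P j then (Num.sqrt S)^-1 else 0)) ^+ 2 * m j
    <= 2 * T / S * (r ^+ k) ^+ 2.
Proof.
set N := Num.sqrt (mass k); set sg := Num.sg x ^+ k; set sS := Num.sqrt S.
have N_gt0 : 0 < N by rewrite sqrtr_gt0 mass_gt0.
have sS_gt0 : 0 < sS by rewrite sqrtr_gt0.
have N2 : N ^+ 2 = mass k by rewrite sqr_sqrtr // ltW // mass_gt0.
have sS2 : sS ^+ 2 = S by rewrite sqr_sqrtr // ltW.
have sg2 : sg ^+ 2 = 1.
  by rewrite /sg -exprM mulnC exprM sqr_sg x_neq0 expr1n.
have xsg : x ^+ k * sg = `|x| ^+ k.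
  by rewrite /sg -exprMn -{1}[x]mulr_sg_norm; congr (_ ^+ _);
     rewrite mulrAC -expr2 sqr_sg x_neq0 mul1r.
set q := sS * (`|x| ^+ k / N).
have q_ge0 : 0 <= q by rewrite mulr_ge0 ?(ltW sS_gt0) ?divr_ge0 ?exprn_ge0 ?(ltW N_gt0).
have q2 : q ^+ 2 = 1 - leak k.
  rewrite /leak !exprMn exprVn sS2 N2 -xsg exprMn sg2 mulr1.
  have := mass_split k; have := mass_gt0 k; move: (mass k) => M M_gt0 ME.
  apply: (mulIf (lt0r_neq0 M_gt0)); rewrite mulrBl mul1r !mulrA.
  by rewrite !divfK ?lt0r_neq0 // ME; ring.
have leak_ge0 : 0 <= leak k by rewrite divr_ge0 // ltW // mass_gt0.
have -> : \sum_j (L j ^+ k / N * sg - (if P j then sS^-1 else 0)) ^+ 2 * m j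
          = 2 - 2 * q.
  rewrite (bigID P) /=.
  rewrite (eq_bigr (fun j => (`|x| ^+ k / N - sS^-1) ^+ 2 * m j)); last first.
    by move=> j Pj; rewrite Pj L_dom // [_ / N * sg]mulrAC xsg.
  rewrite -mulr_sumr -/S.
  rewrite (eq_bigr (fun j => (L j ^+ k) ^+ 2 * m j / mass k)); last first.
    move=> j /negPf ->; rewrite subr0 !exprMn sg2 mulr1 exprVn N2; ring.
  rewrite -mulr_suml -/(tail k) -/(leak k).
  have -> : leak k = 1 - q ^+ 2 by rewrite q2; ring.
  rewrite -sS2 /q; field; by rewrite !gt_eqF.
have := leak_bound k; rewrite -!mulrA; move: (T * _) => B leakB.
have q_le1 : q <= 1.
  by rewrite -(@ler_pXn2r _ 2) ?nnegrE // q2 expr1n; lra.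
(* [1 - q <= 1 - q ^+ 2 = leak k], because [0 <= q <= 1]. *)
nra.
Qed.

(** The Rayleigh quotient is the average of the [L j] for a probability
    distribution that gives mass [leak k] to the [j] outside [P], where
    [L j] differs from [x] by at most [2 * |x|]. *)
Lemma rayleigh_weights_error k :
  `|\sum_j (L j ^+ k / Num.sqrt (mass k)) * (L j * (L j ^+ k / Num.sqrt (mass k)))
       * m j - x| <= 2 * `|x| * (T / S) * (r ^+ k) ^+ 2.
Proof.
have M_gt0 := mass_gt0 k.
have -> : \sum_j (L j ^+ k / Num.sqrt (mass k))
            * (L j * (L j ^+ k / Num.sqrt (mass k))) * m j - x
          = (\sum_(j | ~~ P j) (L j - x) * ((L j ^+ k) ^+ 2 * m j)) / mass k.
  have -> : \sum_(j | ~~ P j) (L j - x) * ((L j ^+ k) ^+ 2 * m j)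
            = \sum_j (L j - x) * ((L j ^+ k) ^+ 2 * m j).
    rewrite [RHS](bigID P) /= [X in _ = X + _]big1 ?add0r // => j Pj.
    by rewrite L_dom // subrr mul0r.
  apply: (mulIf (lt0r_neq0 M_gt0)); rewrite divfK ?lt0r_neq0 //.
  rewrite mulrBl -[x * mass k]/(x * \sum_j (L j ^+ k) ^+ 2 * m j).
  rewrite mulr_suml mulr_sumr -sumrB; apply: eq_bigr => j _.
  rewrite mulrBl; congr (_ - _).
  have : Num.sqrt (mass k) ^+ 2 = mass k by rewrite sqr_sqrtr // ltW.
  have : Num.sqrt (mass k) != 0 by rewrite gt_eqF // sqrtr_gt0.
  by move: (Num.sqrt _) => N N0 <-; field.
rewrite normrM normfV (gtr0_norm M_gt0).
apply: (@le_trans _ _ (2 * `|x| * leak k)); last first.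
  by rewrite -[X in _ <= X]mulrA ler_wpM2l ?mulr_ge0 ?leak_bound.
rewrite /leak mulrA ler_wpM2r ?invr_ge0 ?(ltW M_gt0) // mulr_sumr.
apply: (le_trans (ler_norm_sum _ _ _)); apply: ler_sum => j Pj.
have wj_ge0 : 0 <= (L j ^+ k) ^+ 2 * m j by apply: mulr_ge0; rewrite ?sqr_ge0.
rewrite normrM (ger0_norm wj_ge0); apply: ler_wpM2r => //.
have := ler_normB (L j) x; have := L_sub Pj.
have : r * `|x| <= `|x| by rewrite ler_piMl.
lra.
Qed.

End DominantWeights.

(** * Rates of convergence *)

Lemma bigO_of_le (R : realType) (f g : nat -> R) (C : R) :
  (forall k, `|f k| <= C * `|g k|) -> f =O_\oo g.
Proof.
move=> fg; apply/eqO_exP.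
(* [C] itself may fail to be positive. *)
exists (1 + `|C|); first by rewrite ltr_pwDl.
apply: nearW => k; apply: (le_trans (fg k)); apply: ler_wpM2r => //.
by have := ler_norm C; lra.
Qed.

Lemma cvg0_of_geometric_le (R : realType) (f : nat -> R) (C z : R) :
  `|z| < 1 -> (forall k, 0 <= f k <= C * z ^+ k) -> f @ \oo --> (0 : R).
Proof.
move=> z1 fC; apply: (squeeze_cvgr (nearW _ fC) (cvg_cst _)).
exact: cvg_geometric.
Qed.

(* The dimension is n.+1 and indices start at 0, so ord0 is the paper's index 1
   and l : 'I_n.+1 is the paper's index l + 1 (whence l + 1 <= dimension). *)
Theorem lemma4p2 (R : realType) (n : nat)
    (Q : 'M[dual (quat R)]_n.+1)
    (lam : 'I_n.+1 -> dual R)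
    (u : 'I_n.+1 -> 'cV[dual (quat R)]_n.+1)
    (alpha : 'I_n.+1 -> dual (quat R))
    (l : 'I_n.+1)
    (v y : nat -> 'cV[dual (quat R)]_n.+1)
    (mu : nat -> dual (quat R))
    (Q_herm : dqhermitian Q)
    (Q_eig : forall i, eigenpair Q (lam i) (u i))
    (u_orth : orthonormal_family u)
    (v0E : v 0%N = \sum_j rscale (u j) (alpha j))
    (v0_unit : dqnorm2 (v 0%N) = 1)
    (Qst_neq0 : mst Q != 0)
    (l_gt0 : (0 < l)%N)
    (alpha_neq0 : \sum_(j < n.+1 | (j < l)%N) qabs (st (alpha j)) ^+ 2 != 0)
    (lam_eq : forall j : 'I_n.+1, (j < l)%N -> st (lam j) = st (lam ord0))
    (lam_gap : `|st (lam l)| < `|st (lam ord0)|)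
    (lam_sorted : forall i j : 'I_n.+1, (l <= i)%N -> (i <= j)%N ->
       `|st (lam j)| <= `|st (lam i)|)
    (yE : forall k, y k.+1 = Q *m v k)
    (muE : forall k, mu k = (dqctr (v k) *m y k.+1) 0 0)
    (vE : forall k, v k.+1 = map_mx (fun q => dqdiv q (dqnorm2 (y k.+1))) (y k.+1)) :
  let lam1 : R := st (lam ord0) in
  let s : R := Num.sg lam1 in
  let r : R := `|st (lam l) / lam1| in
  let gamma (j : 'I_n.+1) : quat R :=
    qdiv (st (alpha j))
      (Num.sqrt (\sum_(i < n.+1 | (i < l)%N) qabs (st (alpha i)) ^+ 2)) in
  let w : 'cV[quat R]_n.+1 :=
    \sum_(j < n.+1 | (j < l)%N) rscale (mst (u j)) (gamma j) in
  [/\ exists e : nat -> 'cV[quat R]_n.+1,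
        (forall k, mst (v k) = rscale (w + e k) (qreal (s ^+ k))) /\
        (fun k => qnorm2 (e k)) =O_\oo (fun k => r ^+ k),
      forall k, st (mu k) = (qctr (mst (v k)) *m mst (y k.+1)) 0 0,
      exists c : nat -> R,
        (forall k, st (mu k) = qreal (lam1 * (1 + c k))) /\
        c =O_\oo (fun k => r ^+ (2 * k)%N),
      (fun k => qnorm2 (rscale (mst (v k)) (qreal (s ^+ k)) - w)) @ \oo --> (0 : R) /\
      (fun k => qnorm2 (rscale (mst (v k)) (qreal (s ^+ k)) - w))
        =O_\oo (fun k => r ^+ k) &
      (fun k => qabs (st (mu k) - qreal lam1)) @ \oo --> (0 : R) /\
      (fun k => qabs (st (mu k) - qreal lam1)) =O_\oo (fun k => r ^+ (2 * k)%N)].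
Proof.
move=> lam1 s r gamma w.
pose P : pred 'I_n.+1 := fun j => (j < l)%N.
pose U j := mst (u j); pose a j := st (alpha j); pose L j := st (lam j).
pose m j := qabs (a j) ^+ 2.
pose S := \sum_(j | P j) m j; pose T := \sum_(j | ~~ P j) m j.
have m_ge0 j : 0 <= m j by rewrite sqr_ge0.
have S_gt0 : 0 < S by rewrite lt_def alpha_neq0 sumr_ge0.
have lam1_neq0 : lam1 != 0 by rewrite -normr_gt0 (le_lt_trans _ lam_gap).
have lam1_gt0 : 0 < `|lam1| by rewrite normr_gt0.
have r_ge0 : 0 <= r by rewrite normr_ge0.
have r_lt1 : r < 1 by rewrite /r normrM normfV ltr_pdivrMr // mul1r.
have L_dom j : P j -> L j = lam1 by exact: lam_eq.
have L_sub j : ~~ P j -> `|L j| <= r * `|lam1|.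
  rewrite -leqNgt => lj; rewrite /r normrM normfV divfK ?normr_eq0 //.
  exact: lam_sorted.
have U_orth i j : qdot (U i) (U j) = (i == j)%:R.
  by rewrite -st_dqdot u_orth; case: eqP.
have AU j : mst Q *m U j = rscale (U j) (qreal (L j)).
  by rewrite -mst_mul (Q_eig j).2 mst_rscale.
have V0 : mst (v 0%N) = reweight U a (fun=> 1).
  rewrite v0E mst_sum; apply: eq_bigr => j _.
  by rewrite mst_rscale [qreal 1 * _]mul1r.
have nV0 : qnorm2 (mst (v 0%N)) = 1 by rewrite -st_dqnorm2 v0_unit.
have Y k : mst (y k.+1) = mst Q *m mst (v k) by rewrite yE mst_mul.
have VS k : mst (v k.+1) = rscale (mst Q *m mst (v k))
                             (qreal (qnorm2 (mst Q *m mst (v k)))^-1).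
  by rewrite vE mst_normalize Y.
pose N k := Num.sqrt (\sum_j (L j ^+ k) ^+ 2 * m j).
have V k : mst (v k) = reweight U a (fun j => L j ^+ k / N k).
  apply: (normalized_power U_orth AU V0 nV0 VS) => i.
  exact: (mass_gt0 m_ge0 L_dom lam1_neq0 S_gt0).
have muE' k : st (mu k) = qdot (mst (v k)) (mst (y k.+1)).
  by rewrite muE st_dqdot.
have wE : w = reweight U a (fun j => if P j then (Num.sqrt S)^-1 else 0).
  rewrite /w /reweight big_mkcond; apply: eq_bigr => j _.
  rewrite /P; case: ifP => _; last first.
    by apply/matrixP => i k; rewrite !mxE [qreal 0 * _]mul0r mulr0.
  by rewrite /gamma /qdiv -qreal_central.
pose e k := rscale (mst (v k)) (qreal (s ^+ k)) - w.
have ss k : s ^+ k * s ^+ k = 1.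
  by rewrite -exprMn -expr2 sqr_sg lam1_neq0 expr1n.
have eB k : qnorm2 (e k) <= Num.sqrt (2 * T / S) * r ^+ k.
  have TS_ge0 : 0 <= 2 * T / S by rewrite divr_ge0 ?mulr_ge0 ?sumr_ge0 // ltW.
  rewrite /e V rscale_reweight wE reweightB qnorm2_reweight //.
  rewrite -[r ^+ k]ger0_norm ?exprn_ge0 // -sqrtr_sqr -sqrtrM //.
  apply: ler_wsqrtr.
  exact: (normalized_weights_error m_ge0 L_dom L_sub r_ge0 lam1_neq0 S_gt0).
have eO : (fun k => qnorm2 (e k)) =O_\oo (fun k => r ^+ k).
  apply: (@bigO_of_le _ _ _ (Num.sqrt (2 * T / S))) => k.
  by rewrite !ger0_norm ?sqrtr_ge0 ?exprn_ge0.
pose rho k := \sum_j (L j ^+ k / N k) * (L j * (L j ^+ k / N k)) * m j.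
have muR k : st (mu k) = qreal (rho k).
  by rewrite muE' Y V (mulmx_reweight _ _ AU) qdot_reweight.
have rhoB k : `|rho k - lam1| <= 2 * `|lam1| * (T / S) * (r ^+ 2) ^+ k.
  rewrite -exprM mulnC exprM.
  exact: (rayleigh_weights_error m_ge0 L_dom L_sub r_ge0 (ltW r_lt1)
            lam1_neq0 S_gt0).
have mu_err k : qabs (st (mu k) - qreal lam1) = `|rho k - lam1|.
  by rewrite muR -qrealB qabs_qreal.
split.
- exists e; split=> // k; apply/matrixP => i j.
  by rewrite /e addrC subrK rscaleM -qrealM ss !mxE [_ * qreal 1]mulr1.
- exact: muE'.
- exists (fun k => rho k / lam1 - 1); split=> [k|].
    by rewrite muR; congr qreal; field.
  apply: (@bigO_of_le _ _ _ (2 * (T / S))) => k.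
  rewrite [`|r ^+ _|]ger0_norm ?exprn_ge0 // exprM.
  have -> : rho k / lam1 - 1 = (rho k - lam1) / lam1 by field.
  rewrite normrM normfV ler_pdivrMr //; apply: (le_trans (rhoB k)).
  by rewrite le_eqVlt; apply/orP; left; apply/eqP; ring.
- split=> //.
  apply: (@cvg0_of_geometric_le _ _ (Num.sqrt (2 * T / S)) r) => [|k].
    by rewrite ger0_norm.
  by rewrite eB sqrtr_ge0.
- split; under eq_fun do rewrite mu_err.
    apply: (@cvg0_of_geometric_le _ _ (2 * `|lam1| * (T / S)) (r ^+ 2)) => [|k].
      by rewrite ger0_norm ?exprn_ge0 // exprn_ilt1.
    by rewrite rhoB normr_ge0.
  apply: (@bigO_of_le _ _ _ (2 * `|lam1| * (T / S))) => k.
  by rewrite normr_id [`|r ^+ _|]ger0_norm ?exprn_ge0 // exprM.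
Qed.
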